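(* For every integer $n \geq 3$, the Italian domination number of the Sierpi\'{n}ski graph $S(K_n,3)$ is $\gamma_I(S(K_n,3)) = 2n(n-1)$.
   Context: Sierpi\'{n}ski graph: for a graph $G$ with vertex set $V$ of order $n\ge 2$ and a positive integer $t$, $S(G,t)$ has as vertex set the set $V^t$ of words $u=u_1u_2\cdots u_t$ of length $t$ over the alphabet $V$. For $G=K_n$, two words $u,v$ are adjacent in $S(K_n,t)$ if and only if there is $i\in\{1,\dots,t\}$ such that $u_j=v_j$ for $j<i$, $u_i\neq v_i$, and $u_j=v_i$ and $v_j=u_i$ for all $j>i$. An Italian dominating function (IDF) of a graph $G$ is a function $f:V(G)\to\{0,1,2\}$ such that every vertex $v$ with $f(v)=0$ satisfies $\sum_{u\in N(v)} f(u)\ge 2$, where $N(v)$ is the open neighbourhood of $v$. The weight of $f$ is $\sum_{v\in V(G)} f(v)$, and the Italian domination number $\gamma_I(G)$ is the minimum weight of an IDF of $G$. *)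

(* Defs.v *)
From mathcomp Require Import all_boot.

Set Implicit Arguments.
Unset Strict Implicit.
Unset Printing Implicit Defensive.

(* A simple graph on a finite vertex type [T] is its adjacency relation
   [e : rel T], symmetric and irreflexive. *)

Section ItalianDomination.
Variables (T : finType) (e : rel T).
Implicit Type f : {ffun T -> 'I_3}.

Definition italian_dominating f : bool :=
  [forall v, (f v == 0 :> nat) ==> (2 <= \sum_(u | e v u) f u)].

Definition idf_weight f : nat := \sum_v f v.

Definition const2 : {ffun T -> 'I_3} := [ffun=> ord_max].

Lemma italian_dominating_const2 : italian_dominating const2.
Proof. by apply/forallP=> v; rewrite ffunE. Qed.

(* [const2] only witnesses that IDFs exist, so that the minimum is taken over
   a nonempty set; see [italian_domP]. *)
Definition italian_domination_number : nat :=
  idf_weight [arg min_(f < const2 | italian_dominating f) idf_weight f].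

Lemma italian_domP :
  (exists2 f, italian_dominating f & idf_weight f = italian_domination_number)
  /\ (forall f, italian_dominating f ->
        italian_domination_number <= idf_weight f).
Proof.
rewrite /italian_domination_number.
case: arg_minnP => [|f fP fmin]; first exact: italian_dominating_const2.
by split=> //; exists f.
Qed.

End ItalianDomination.

(* The Sierpinski graph S(K_n, t): words of length [t] over the vertex set
   ['I_n] of K_n; positions are numbered from 0. *)
Definition sierpinski (n t : nat) : rel (t.-tuple 'I_n) := fun u v =>
  [exists i : 'I_t,
    [&& [forall j : 'I_t, (j < i) ==> (tnth u j == tnth v j)],
        tnth u i != tnth v i
      & [forall j : 'I_t, (i < j) ==>
           (tnth u j == tnth v i) && (tnth v j == tnth u i)]]].

Lemma sierpinski_sym n t : symmetric (@sierpinski n t).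
Proof.
move=> u v; apply: eq_existsb => i; congr [&& _, _ & _].
- by apply: eq_forallb => j; rewrite eq_sym.
- by rewrite eq_sym.
- by apply: eq_forallb => j; rewrite andbC.
Qed.

Lemma sierpinski_irrefl n t : irreflexive (@sierpinski n t).
Proof.
by move=> u; apply/existsP=> -[i /and3P[_ /eqP]].
Qed.

(* Main.v *)
(* Fix the first letter [a] and write [R b] for the weight of the clique of
   words [ab*]; the lower bound is [2(n - 1) <= \sum_b R b] for every [a].
   If [R b = 0], then every vertex [acb] has value 2, so the other cliques have
   weight at least 2. Otherwise let [B] be the set of the [k] letters [b] with [R b = 1].
   Any two [b, c] in [B] satisfy [f(abc) + f(acb) >= 1], which uses up
   [k(k-1)/2] of the weight [k] carried by [B]. If [a] is in [B], then
   [f(aaa) = 1] because [aaa] has no neighbour outside its clique, whence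
   [k <= 2]. If [a] is not in [B], then [f(aba) + f(aab) >= 1] for [b] in [B],
   and the loss [k] is compensated by [R a >= k(k-1)/2].
   The bound is attained by the function that is 1 at [ab(a+1)] for all [b] and
   at [ab(a-1)] for [b] distinct from [a+1] and [a-1] (letters mod [n]). *)
Require Import Defs.
From mathcomp Require Import all_boot zify.

Set Implicit Arguments.
Unset Strict Implicit.
Unset Printing Implicit Defensive.

Lemma sum_tuple3 (T : finType) (F : 3.-tuple T -> nat) :
  \sum_u F u = \sum_a \sum_b \sum_c F [tuple a; b; c].
Proof.
pose h (p : T * (T * T)) : 3.-tuple T := [tuple p.1; p.2.1; p.2.2].
rewrite (reindex h) /=.
  by rewrite -(pair_big xpredT xpredT (fun a q => F (h (a, q)))) /=;
     apply: eq_bigr => a _;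
     rewrite -(pair_big xpredT xpredT (fun b c => F (h (a, (b, c))))).
exists (fun u => (thead u, (tnth u (inord 1), tnth u (inord 2)))).
  by move=> [a [b c]] _; rewrite /h /= !(tnth_nth a) !inordK.
move=> u _; case: u => -[|a [|b [|c [|? ?]]]] // Hu.
by apply: val_inj; rewrite /h /thead /= !(tnth_nth a) /= !inordK.
Qed.

Lemma forall_ord3 (P : pred 'I_3) :
  [forall i, P i] = [&& P (@Ordinal 3 0 isT), P (@Ordinal 3 1 isT) & P (@Ordinal 3 2 isT)].
Proof.
apply/forallP/and3P=> [P_all|[P0 P1 P2] [[|[|[|//]]] lt_i3]]; first by split.
- by rewrite (_ : Ordinal _ = @Ordinal 3 0 isT) //; apply: val_inj.
- by rewrite (_ : Ordinal _ = @Ordinal 3 1 isT) //; apply: val_inj.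
- by rewrite (_ : Ordinal _ = @Ordinal 3 2 isT) //; apply: val_inj.
Qed.

Lemma exists_ord3 (P : pred 'I_3) :
  [exists i, P i] = [|| P (@Ordinal 3 0 isT), P (@Ordinal 3 1 isT) | P (@Ordinal 3 2 isT)].
Proof. by rewrite -[LHS]negbK negb_exists forall_ord3 !negb_and !negbK. Qed.

Lemma eq_tuple3 (T : eqType) (a b c a' b' c' : T) :
  ([tuple a; b; c] == [tuple a'; b'; c']) = ((a, b, c) == (a', b', c')).
Proof. by rewrite -val_eqE /= !eqseq_cons eqxx andbT andbA. Qed.

Section Neighbourhoods.
Variable n : nat.
Implicit Types (a b c : 'I_n) (f : 3.-tuple 'I_n -> nat).

(* The endpoint of the unique edge leaving the clique of words [ab*] from
   [abc]; an extreme vertex [aaa] has none and is its own value here. *)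
Definition ext_nbr a b c : 3.-tuple 'I_n :=
  if b == c then [tuple b; a; a] else [tuple a; c; b].

(** Two words first differ at the last letter inside a clique, and earlier along an external edge.
    The inequality excludes the vertex itself, hence also the value of [ext_nbr] at [aaa]. *)
Lemma sierpinski3E a b c a' b' c' :
  @sierpinski n 3 [tuple a; b; c] [tuple a'; b'; c'] =
  ((a', b', c') != (a, b, c)) &&
  (((a == a') && (b == b'))
   || ([tuple a'; b'; c'] == ext_nbr a b c)).
Proof.
rewrite /sierpinski exists_ord3 !forall_ord3 !(tnth_nth a) /=.
rewrite /ext_nbr (fun_if (eq_op _)) !eq_tuple3 !xpair_eqE.
rewrite -!val_eqE /=; case: ifP; lia.
Qed.

(** As [f] vanishes at [abc], the vertex itself may join the sum over its clique, and [aaa] may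
    serve as its own external neighbour. *)
Lemma nbr_sum f a b c : f [tuple a; b; c] = 0 ->
  \sum_(u | @sierpinski n 3 [tuple a; b; c] u) f u
    = \sum_d f [tuple a; b; d] + f (ext_nbr a b c).
Proof.
move=> f0.
have -> : \sum_d f [tuple a; b; d] =
    \sum_(u : 3.-tuple 'I_n) ((a == thead u) && (b == tnth u (inord 1))) * f u.
  rewrite sum_tuple3 [RHS](bigD1 a) //= [X in _ + X]big1 ?addn0; last first.
    move=> a' /negPf Ha; rewrite big1 // => b' _; rewrite big1 // => c' _.
    by rewrite theadE eq_sym Ha.
  rewrite [RHS](bigD1 b) //= [X in _ + X]big1 ?addn0; last first.
    move=> b' /negPf Hb; rewrite big1 // => c' _.
    by rewrite (tnth_nth a) inordK //= [b == b']eq_sym Hb andbF.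
  by apply: eq_bigr => c' _; rewrite theadE (tnth_nth a) inordK //= (eqxx a) (eqxx b) mul1n.
have -> : f (ext_nbr a b c) = \sum_u (u == ext_nbr a b c) * f u.
  by rewrite (bigD1 (ext_nbr a b c)) //= eqxx mul1n big1 ?addn0 // => u /negPf ->.
rewrite -big_split big_mkcond !sum_tuple3 /=.
apply: eq_bigr => a' _; apply: eq_bigr => b' _; apply: eq_bigr => c' _.
rewrite sierpinski3E theadE (tnth_nth a) inordK //=.
rewrite -mulnDl.
case: (altP eqP) => [[-> -> ->]|]; first by rewrite f0 muln0.
rewrite /=; set in_clique := _ && _; set is_ext := _ == ext_nbr _ _ _.
move: (f _) => k neq_v.
(* No vertex is counted twice: the external neighbour lies in the clique only if it is [abc]
   itself. *)
have: ~~ (in_clique && is_ext).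
  rewrite /in_clique /is_ext /ext_nbr (fun_if (eq_op _)) !eq_tuple3 !xpair_eqE.
  move: neq_v; rewrite !xpair_eqE -!val_eqE /=; case: ifP; lia.
by case: in_clique; case: is_ext => //= _; rewrite ?mul1n ?addn0 ?mul1n.
Qed.

End Neighbourhoods.

(** Here [g b c] stands for [f(abc)]. Only vertices without neighbours outside the copy of [a] are
    constrained ([abb] with [b] distinct from [a] is adjacent to [baa]), so each copy is bounded on
    its own. *)
Lemma sum_copy_lb n (g : 'I_n -> 'I_n -> nat) (a : 'I_n) :
    (forall b c, c != b -> g b c = 0 -> 2 <= \sum_d g b d + g c b) ->
    (g a a = 0 -> 2 <= \sum_d g a d) ->
  2 * (n - 1) <= \sum_b \sum_c g b c.
Proof.
move=> g_dom ga_dom; pose R b := \sum_c g b c.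
have le_R b (P : pred 'I_n) : \sum_(c | P c) g b c <= R b.
  by rewrite /R [leqRHS](bigID P) leq_addr.
have le_R1 b c : g b c <= R b by rewrite -(big_pred1_eq addn c (g b)) le_R.
change (2 * (n - 1) <= \sum_b R b).
have [b Rb0|R_neq0] := pickP (fun b => R b == 0).
  rewrite (bigD1 b) //= (eqP Rb0) add0n mulnC.
  have -> : n - 1 = #|predC1 b| by rewrite cardC1 card_ord subn1.
  rewrite -sum_nat_const; apply: leq_sum => c neq_cb.
  have gbc0: g b c = 0 by have := le_R1 b c; rewrite (eqP Rb0); lia.
  have := g_dom _ _ neq_cb gbc0; rewrite -/(R b) (eqP Rb0); have := le_R1 c b; lia.
have R_gt0 b : 0 < R b by have := R_neq0 b; lia.
pose B := [set b | R b == 1]; pose k := #|B|.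
have R_B b : b \in B -> R b = 1 by rewrite inE => /eqP.
have g_B b c : b \in B -> c != b -> 1 <= g b c + g c b.
  move=> /R_B Rb1 neq_cb; case: (posnP (g b c)) => [gbc0|]; last by lia.
  by have := g_dom _ _ neq_cb gbc0; rewrite -/(R b) Rb1; lia.
pose S := \sum_(b in B) \sum_(c in B | c != b) g b c.
have S_ge : k * (k - 1) <= 2 * S.
  (* Symmetrising makes each ordered pair of distinct letters of [B] contribute at least 1. *)
  have -> : 2 * S = \sum_(b in B) \sum_(c in B | c != b) (g b c + g c b).
    under [RHS]eq_bigr do rewrite big_split.
    rewrite big_split mul2n -addnn; congr (_ + _).
    rewrite [RHS](exchange_big_dep (mem B)) /=; last by move=> ? ? _ /andP[].
    apply: eq_bigr => c cB; apply: eq_bigl => b.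
    by rewrite cB eq_sym.
  rewrite /k -sum_nat_const; apply: leq_sum => b bB.
  have -> : #|B| - 1 = #|[pred c in B | c != b]|.
    rewrite (cardsD1 b) bB addnC addnK -cardsE; apply: eq_card => c.
    by rewrite !inE andbC.
  by rewrite -sum1_card; apply: leq_sum => c /andP[_]; exact: g_B.
(* Every [R b + (b \in B)] is at least 2; the excess at [a] is retained. *)
have sumR_ge : 2 * n + (R a + (a \in B) - 2) <= \sum_b R b + k.
  have -> : k = \sum_b (b \in B).
    by rewrite /k -sum1_card big_mkcond; apply: eq_bigr => b _; case: ifP.
  rewrite -big_split (bigD1 a) //=.
  have -> : 2 * n = 2 + \sum_(b | b != a) 2.
    rewrite sum_nat_const cardC1 card_ord; have := ltn_ord a; lia.
  have : \sum_(b | b != a) 2 <= \sum_(b | b != a) (R b + (b \in B)).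
    by apply: leq_sum => b _; have := R_gt0 b; rewrite inE; case: eqP; lia.
  have : 2 <= R a + (a \in B) by have := R_gt0 a; rewrite inE; case: eqP; lia.
  by move=> R_a_ge2 le_rest; rewrite addnAC subnKC // leq_add2l.
have [aB|aNB] := boolP (a \in B).
  have ga1 : 1 <= g a a.
    by case: (posnP (g a a)) => // /ga_dom; rewrite -/(R a) R_B.
  (* The entry [g a a] belongs to row [a] but not to [S]. *)
  have : 1 + S <= k.
    rewrite /k -sum1_card /S (bigD1 a) // [leqRHS](bigD1 a) //= addnA.
    apply: leq_add.
      rewrite -[leqRHS](R_B a aB) /R [leqRHS](bigD1 a) //= leq_add //.
      by rewrite [leqRHS](bigID (mem B)) /= (eq_bigl _ _ (fun c => andbC _ _)) leq_addr.
    apply: leq_sum => b /andP[/R_B <- _]; exact: le_R.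
  nia.
have : S + k <= R a + k.
  have : \sum_(b in B) (g b a + g a b) + S <= R a + k.
    rewrite big_split /= addnAC addnC leq_add ?le_R //.
    rewrite /S -big_split /k -sum1_card; apply: leq_sum => b bB /=.
    rewrite -(R_B b bB) /R [leqRHS](bigD1 a) //= leq_add //.
    rewrite [leqRHS](bigID (mem B)) /=; apply: leq_trans (leq_addr _ _).
    rewrite [leqRHS](bigID (pred1 b)) /=; apply: leq_trans (leq_addl _ _).
    rewrite leq_eqVlt; apply/orP; left; apply/eqP; apply: eq_bigl => c.
    by have [->|] := eqVneq c a; rewrite ?(negPf aNB).
  have : k <= \sum_(b in B) (g b a + g a b).
    rewrite /k -sum1_card; apply: leq_sum => b bB; apply: g_B => //.
    by apply: contraNneq aNB => ->.
  lia.
(* It remains to see that [R a >= k]: this bound suffices for [k <= 2], and [R a >= S >= k(k-1)/2]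
   for [k >= 3]. *)
have : 2 <= R a by move: aNB (R_gt0 a); rewrite inE; case: eqP; lia.
nia.
Qed.

Lemma ordS_neq_pred n (a : 'I_n) : 3 <= n -> ordS a != ord_pred a.
Proof.
move=> n_ge3; rewrite -val_eqE /=; move: (nat_of_ord a) (ltn_ord a) => {a} i.
(* The successor wraps around at the last letter; below, the predecessor does at 0. *)
rewrite leq_eqVlt => /predU1P[def_n|lt_i1n].
  have -> : (i + n).-1 = i.-1 + n by lia.
  by rewrite def_n modnn modnDr modn_small; lia.
rewrite modn_small //; case: i lt_i1n => [|i] lt_i1n.
  by rewrite add0n modn_small; lia.
by rewrite addSn /= modnDr modn_small; lia.
Qed.

Section UpperBound.
Variable n : nat.
Hypothesis n_ge3 : 3 <= n.

Definition cyclic_val (a b c : 'I_n) : bool :=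
  (c == ordS a) || (c == ord_pred a) && (b \notin [:: ordS a; ord_pred a]).

Lemma cyclic_row_sum a b :
  \sum_c cyclic_val a b c = 1 + (b \notin [:: ordS a; ord_pred a]).
Proof.
have neq_pq := ordS_neq_pred a n_ge3; rewrite /cyclic_val.
rewrite (bigD1 (ordS a)) //= eqxx (bigD1 (ord_pred a)) /=; last by rewrite eq_sym.
rewrite eqxx orbC eq_sym (negPf neq_pq) orbF big1 ?addn0 //.
by move=> c /andP[/negPf-> /negPf->].
Qed.

Definition cyclic_idf : {ffun 3.-tuple 'I_n -> 'I_3} :=
  [ffun u => inord (cyclic_val (thead u) (tnth u (inord 1)) (tnth u (inord 2)))].

Lemma cyclic_idfE a b c : cyclic_idf [tuple a; b; c] = cyclic_val a b c :> nat.
Proof.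
rewrite ffunE theadE !(tnth_nth a) inordK ?inordK //=.
by case: cyclic_val.
Qed.

(** A clique of weight 2 dominates its own vertices. If [b] is [a+1] or [a-1], the clique has weight
    1, and a vertex of value 0 has an external neighbour of value 1. *)
Lemma cyclic_idf_dominating : italian_dominating (@sierpinski n 3) cyclic_idf.
Proof.
apply/forallP => u; apply/implyP; case/tupleP: u => a u; case/tupleP: u => b u.
case/tupleP: u => c u; rewrite (tuple0 u) => /eqP f0.
rewrite (nbr_sum (f := fun u => cyclic_idf u)) //.
rewrite cyclic_idfE in f0.
under eq_bigr do rewrite cyclic_idfE.
rewrite cyclic_row_sum.
have [|/negPn b_pq] := boolP (b \notin _); first by move=> _; apply: leq_addr.
have cNp : c != ordS a by move: f0; rewrite /cyclic_val; case: eqP.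
rewrite addn0 add1n ltnS /ext_nbr; have [eq_bc|neq_bc] := eqVneq b c.
  move: b_pq; rewrite eq_bc !inE (negPf cNp) /= => /eqP->.
  by rewrite cyclic_idfE /cyclic_val ord_predK eqxx.
rewrite cyclic_idfE /cyclic_val.
move: b_pq neq_bc; rewrite !inE => /pred2P[]->; rewrite eqxx //= => neq_qc.
by rewrite (negPf cNp) (eq_sym c) (negPf neq_qc) orbT.
Qed.

(** Each copy has two cliques of weight 1 and [n - 2] of weight 2. *)
Lemma cyclic_idf_weight : idf_weight cyclic_idf = 2 * n * (n - 1).
Proof.
rewrite /idf_weight sum_tuple3.
rewrite -mulnA mulnCA -[in RHS](card_ord n) -sum_nat_const.
apply: eq_bigr => a _.
under eq_bigr do under eq_bigr do rewrite cyclic_idfE.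
under eq_bigr do rewrite cyclic_row_sum.
rewrite big_split /= sum1_card card_ord.
have -> : \sum_(b < n) (b \notin [:: ordS a; ord_pred a]) =
    #|predC (mem [:: ordS a; ord_pred a])|.
  by rewrite -sum1_card [RHS]big_mkcond; apply: eq_bigr => b _; rewrite !inE; case: ifP.
have card_pq : #|[:: ordS a; ord_pred a]| = 2.
  by apply/card_uniqP; rewrite /= inE ordS_neq_pred.
have : #|predC (mem [:: ordS a; ord_pred a])| = n - 2.
  by rewrite -[in RHS](card_ord n) -(cardC (mem [:: ordS a; ord_pred a])) card_pq addKn.
move=> ->; lia.
Qed.

End UpperBound.

Theorem theorem3p2 (n : nat) (hn : 3 <= n) :
  italian_domination_number (@sierpinski n 3) = 2 * n * (n - 1).
Proof.
have [[f f_dom <-] weight_min] := italian_domP (@sierpinski n 3).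
apply/eqP; rewrite eqn_leq; apply/andP; split.
  by rewrite -(cyclic_idf_weight hn) weight_min // cyclic_idf_dominating.
rewrite /idf_weight sum_tuple3 -mulnA mulnCA.
rewrite -[X in X * _](card_ord n) -sum_nat_const.
have f_ge2 v : f v = 0 :> nat -> 2 <= \sum_(u | @sierpinski n 3 v u) f u.
  by move=> fv0; apply: (implyP (forallP f_dom v)); rewrite fv0.
apply: leq_sum => a _; apply: (sum_copy_lb (a := a)) => [b c neq_cb|] fv0.
  have := f_ge2 _ fv0; rewrite (nbr_sum (f := fun u => f u)) // /ext_nbr.
  by rewrite eq_sym (negPf neq_cb).
have := f_ge2 _ fv0; rewrite (nbr_sum (f := fun u => f u)) // /ext_nbr eqxx.
by rewrite fv0 addn0.
Qed.
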